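(* Let $d > 0$ be an integer, let $h \in \mathcal{H}$, let $n = h+d$, and let $\delta = 6d^3/h$. Assume $\delta \le 1$. Then \[ \frac{D(n)}{h^{n/2}} \ge (0.594)^d\,(1 - 0.93\,\delta) \] and \[ \overline{D}(n) \ge (0.352)^d\,(1 - 0.93\,\delta) \ge 0.07\,(0.352)^d. \]
   Context: A Hadamard matrix of order $h$ is an $h\times h$ matrix $H$ with entries in $\{\pm1\}$ satisfying $HH^T = hI$. $\mathcal{H}$ denotes the set of positive integers $h$ for which a Hadamard matrix of order $h$ exists. $D(n)$ denotes the maximal determinant of an $n\times n$ matrix with entries in the real interval $[-1,1]$, and $\overline{D}(n) := D(n)/n^{n/2}$. *)

(* Defs.v *)
From mathcomp Require Import all_boot all_order all_algebra perm.
From mathcomp Require Import all_classical all_reals all_analysis.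

Set Implicit Arguments.
Unset Strict Implicit.
Unset Printing Implicit Defensive.
Import Order.TTheory GRing.Theory Num.Theory numFieldNormedType.Exports.
Local Open Scope classical_set_scope.
Local Open Scope ring_scope.

Definition is_hadamard (h : nat) (H : 'M[int]_h) : Prop :=
  (forall i j, H i j = 1 \/ H i j = -1) /\ H *m H^T = (h%:R)%:M.

Definition hadamard_orders : set nat :=
  [set h | (0 < h)%N /\ exists H : 'M[int]_h, is_hadamard H].

Definition unit_box_mx (R : realType) (n : nat) : set 'M[R]_n :=
  [set A | forall i j, -1 <= A i j <= 1].

(* [sup] is total with junk value 0; [maxdet_attained] below shows that here it
   is a genuine maximum. *)
Definition maxdet (R : realType) (n : nat) : R :=
  sup [set \det A | A in @unit_box_mx R n].

Definition norm_maxdet (R : realType) (n : nat) : R :=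
  maxdet R n / n%:R `^ (n%:R / 2).

Lemma det_vec_mx_continuous (R : realType) (n : nat) :
  continuous (fun v : 'rV[R]_(n * n) => \det (vec_mx v)).
Proof.
rewrite /determinant.
apply: (continuous_big (op := +%R)); first exact: add_continuous.
move=> s _ w; apply: (@cvgM R _ (nbhs w)); first exact: cvg_cst.
have cM : continuous (fun x : R * R => x.1 * x.2) by exact: mul_continuous.
move: w; apply: (continuous_big cM) => i _.
rewrite [X in continuous X](_ : _ =
  (fun v : 'rV[R]_(n * n) => v ord0 (mxvec_index i (s i)))).
  exact: coord_continuous.
by apply/funext => v; rewrite mxE.
Qed.

Lemma maxdet_attained (R : realType) (n : nat) :
  (exists2 A : 'M[R]_n, unit_box_mx A & \det A = maxdet R n) /\
  (forall A : 'M[R]_n, unit_box_mx A -> \det A <= maxdet R n).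
Proof.
pose B : set 'rV[R]_(n * n) := [set v | forall k, `[-1, 1]%classic (v ord0 k)].
have BE A : unit_box_mx A -> B (mxvec A).
  by move=> hA k; case/mxvec_indexP: k => i j; rewrite mxvecE /= in_itv /=.
have EB v : B v -> unit_box_mx (vec_mx v : 'M[R]_n).
  by move=> hv i j; rewrite mxE; have := hv (mxvec_index i j); rewrite /= in_itv.
have B0 : B 0 by move=> k; rewrite mxE /= in_itv /= lerN10 ler01.
have [] := @compact_EVT_max _ R
  (fun v : 'rV[R]_(n * n) => \det (vec_mx v)) B.
- by exists 0.
- by apply: (@rV_compact R _ (fun=> `[-1, 1]%classic)) => k; exact: segment_compact.
- exact/continuous_subspaceT/det_vec_mx_continuous.
move=> c; rewrite inE => Bc cmax.
have ub (A : 'M[R]_n) : unit_box_mx A -> \det A <= \det (vec_mx c).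
  move=> hA; have /= := cmax (mxvec A); rewrite mxvecK; apply.
  by rewrite inE; exact: BE.
have E : \det (vec_mx c) = maxdet R n.
  apply/eqP; rewrite eq_le; apply/andP; split.
    apply: ub_le_sup; last by exists (vec_mx c) => //; exact: EB.
    by exists (\det (vec_mx c)) => _ [A hA <-]; exact: ub.
  apply: ge_sup; first by exists (\det (vec_mx c)), (vec_mx c) => //; exact: EB.
  by move=> _ [A hA <-]; exact: ub.
by split; [exists (vec_mx c) => //; exact: EB | rewrite -E].
Qed.

(* Main.v *)
(* Border a Hadamard matrix [H] of order [h] by [d] random sign columns [B], by
   the rows [- C] where [C] consists of the signs of the columns of [H^T B], and
   by a zero block.  Up to sign the determinant is then
   [h^(h/2) det (C H^T B) / h^d].  Since the correlation of
   [sg (H^T w)_k] with [(H^T w)_l] over random signs [w] vanishes for [k <> l],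
   the Leibniz expansion gives the exact average
   [E det (C H^T B) = mu^d h (h - 1) ... (h - d + 1)], where
   [mu = E |w_1 + ... + w_h| >= sqrt (h / 2)].  As [sqrt (1 / 2) > 0.707], this
   leaves enough room for both bounds. *)
Require Import Defs.
From mathcomp Require Import all_boot all_order all_algebra.
From mathcomp Require Import all_classical all_reals all_analysis.
From mathcomp Require Import perm fingroup zify ring lra.

Set Implicit Arguments.
Unset Strict Implicit.
Unset Printing Implicit Defensive.

Import Order.TTheory GRing.Theory Num.Theory numFieldNormedType.Exports.
Local Open Scope classical_set_scope.
Local Open Scope ring_scope.

(** * Averages of determinants of Gram type *)

Lemma det_delta_ffun (R : comPzRingType) (d h : nat) (f : {ffun 'I_d -> 'I_h}) :
  \det (\matrix_(i, j) (f i == f j)%:R : 'M[R]_d) = (injectiveb f)%:R.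
Proof.
case: (boolP (injectiveb f)) => [/injectiveP f_inj | /injectivePn[i [j neq eq_f]]].
  transitivity (\det (1%:M : 'M[R]_d)); last exact: det1.
  congr (\det _); apply/matrixP => i j.
  by rewrite !mxE (inj_eq f_inj).
by apply: (determinant_alternate neq) => k; rewrite !mxE eq_f.
Qed.

(** After the Leibniz expansion each [b i] occurs only in one pair [u (b i) _ * v (b i) _], so the
    sum over [b] factorizes. By the hypothesis only [kappa ^+ d] times a determinant of Kronecker
    deltas in [f] survives, which is 1 or 0 according to injectivity; [h ^_ d] counts the
    injections. *)
Lemma sum_det_gram (R : comPzRingType) (Omega : finType) (d h : nat)
    (u v : Omega -> 'I_h -> R) (kappa : R) :
  (forall k l, \sum_w u w k * v w l = kappa * (k == l)%:R) ->
  \sum_(b : {ffun 'I_d -> Omega})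
     \det (\matrix_(i, j) \sum_k u (b i) k * v (b j) k) =
  kappa ^+ d * (h ^_ d)%:R.
Proof.
move=> uvE.
have expand (b : {ffun 'I_d -> Omega}) :
  \det (\matrix_(i, j) \sum_k u (b i) k * v (b j) k) =
  \sum_(f : {ffun 'I_d -> 'I_h}) \sum_(s : 'S_d)
     (-1) ^+ s * \prod_i (u (b i) (f i) * v (b i) (f ((s^-1)%g i))).
  rewrite exchange_big; apply: eq_bigr => s _ /=.
  under eq_bigr do rewrite mxE.
  rewrite bigA_distr_bigA mulr_sumr; apply: eq_bigr => f _.
  rewrite !big_split /=; congr (_ * (_ * _)).
  (* The [v] factors are permuted by [s], so that everything depending on the same [b i] stands
     together. *)
  rewrite [RHS](reindex_inj (@perm_inj _ s)) /=.
  by apply: eq_bigr => i _; rewrite permK.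
under eq_bigr do rewrite expand.
rewrite exchange_big /=.
have inner (f : {ffun 'I_d -> 'I_h}) :
  \sum_(b : {ffun 'I_d -> Omega}) \sum_(s : 'S_d)
     (-1) ^+ s * \prod_i (u (b i) (f i) * v (b i) (f ((s^-1)%g i))) =
  kappa ^+ d * (injectiveb f)%:R.
  rewrite -det_delta_ffun /determinant mulr_sumr exchange_big /=.
  rewrite [RHS](reindex_inj invg_inj) /=; apply: eq_bigr => s _.
  rewrite -mulr_sumr odd_permV mulrCA; congr (_ * _).
  rewrite -(bigA_distr_bigA
    (fun i w => u w (f i) * v w (f ((s^-1)%g i)))) /=.
  under eq_bigr do rewrite uvE.
  rewrite big_split /= prodr_const card_ord; congr (_ * _).
  by apply: eq_bigr => i _; rewrite mxE.
under eq_bigr do rewrite inner.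
rewrite -mulr_sumr -natr_sum -big_mkcond /= sum1_card.
by rewrite -cardsE card_inj_ffuns !card_ord.
Qed.

(** * Binomial sums and the central binomial coefficient *)

(* Telescoping: [(n - 2 k) 'C(n, k) = (k + 1) 'C(n, k + 1) - k 'C(n, k)]. *)
Lemma sum_dist_bin (R : realDomainType) (m : nat) :
  \sum_(0 <= k < (2 * m).+1) `|(2 * m)%:R - (2 * k)%:R| *+ 'C(2 * m, k) =
  (2 * m * 'C(2 * m, m))%:R :> R.
Proof.
pose f k : R := (k * 'C(2 * m, k))%:R.
have fE k : ((2 * m)%:R - (2 * k)%:R) *+ 'C(2 * m, k) = f k.+1 - f k.
  rewrite /f mul_bin_left; case: (leqP k (2 * m)) => [le_k | lt_k].
    by rewrite !natrM natrB // -mulr_natr !natrM; ring.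
  by rewrite bin_small // !muln0 subr0 mulr0n.
rewrite (big_cat_nat (n := m)) //=; last lia.
rewrite (eq_big_nat _ _ (F2 := fun k => f k.+1 - f k)); last first.
  by move=> k /andP[_ ltk]; rewrite -fE ger0_norm ?subr_ge0 ?ler_nat //; lia.
rewrite telescope_sumr // [X in _ + X](eq_big_nat _ _
    (F2 := fun k => - (f k.+1 - f k))); last first.
  move=> k /andP[lek _]; rewrite -fE ler0_norm ?mulNrn //.
  by rewrite subr_le0 ler_nat; lia.
rewrite sumrN telescope_sumr; last lia.
rewrite {3}/f bin_small // muln0 sub0r opprK {2}/f mul0n subr0.
by rewrite -natrD; congr _%:R; lia.
Qed.

(** Equality holds at [m = 1], and the inductive step reduces to
    [4 (m + 1) (m + 2) <= (2 m + 3) ^ 2], where the sides differ by 1. *)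
Lemma exp16_le_central_bin (m : nat) :
  (0 < m)%N -> (16 ^ m <= 4 * m * 'C(2 * m, m) ^ 2)%N.
Proof.
case: m => // m _; elim: m => [//|m IH].
have E : (m.+2 * 'C(2 * m.+2, m.+2) = 2 * (2 * m + 3) * 'C(2 * m.+1, m.+1))%N.
  have H1 := mul_bin_diag (2 * m.+2) m.+1.
  have H2 := mul_bin_down (2 * m + 3) m.+1.
  rewrite (_ : (2 * m.+2).-1 = (2 * m + 3)%N) in H1; last lia.
  rewrite (_ : (2 * m + 3).-1 = (2 * m.+1)%N) in H2; last lia.
  rewrite (_ : (2 * m + 3 - m.+1 = m.+2)%N) in H2; last lia.
  by rewrite -H1; lia.
move: E IH; set C' := 'C(_, m.+2); set C := 'C(_, m.+1) => E IH.
rewrite -(leq_pmul2l (isT : 0 < m.+2)%N) expnS.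
have -> : (m.+2 * (4 * m.+2 * C' ^ 2) = 4 * (m.+2 * C') ^ 2)%N by ring.
rewrite E; apply: (@leq_trans (m.+2 * (16 * (4 * m.+1 * C ^ 2)))).
  by rewrite leq_mul2l leq_mul2l IH.
have -> : (m.+2 * (16 * (4 * m.+1 * C ^ 2)) = 64 * m.+1 * m.+2 * C ^ 2)%N by ring.
have -> : (4 * (2 * (2 * m + 3) * C) ^ 2 = 16 * (2 * m + 3) ^ 2 * C ^ 2)%N by ring.
by rewrite leq_mul2r; apply/orP; right; nia.
Qed.

(** * Random sign vectors *)

Definition sign_vec (R : pzRingType) (h : nat) (w : {ffun 'I_h -> bool})
  (i : 'I_h) : R := (-1) ^+ w i.

(** This is [2 ^ h * mu]: sums over the finite sample space replace expectations. *)
Definition abs_sign_sum (R : numDomainType) (h : nat) : R :=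
  \sum_(w : {ffun 'I_h -> bool}) `|\sum_k sign_vec R w k|.

Lemma sum_sg_sign_swap (R : realDomainType) (h : nat) (i j : 'I_h) :
  \sum_w Num.sg (\sum_k sign_vec R w k) * sign_vec R w i =
  \sum_w Num.sg (\sum_k sign_vec R w k) * sign_vec R w j.
Proof.
pose p (w : {ffun 'I_h -> bool}) := [ffun k => w (tperm i j k)].
have pK : involutive p by move=> w; apply/ffunP => k; rewrite !ffunE tpermK.
rewrite (reindex_inj (inv_inj pK)) /=; apply: eq_bigr => w _.
congr (Num.sg _ * _); last by rewrite /sign_vec ffunE tpermL.
rewrite [RHS](reindex_inj (@perm_inj _ (tperm i j))) /=.
by apply: eq_bigr => k _; rewrite /sign_vec ffunE.
Qed.

(** Write [|S| = sg S * S] and expand the second factor; by symmetry all [h] coordinates contribute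
    equally. *)
Lemma sum_sg_sign (R : realDomainType) (h : nat) (i : 'I_h) :
  h%:R * (\sum_w Num.sg (\sum_k sign_vec R w k) * sign_vec R w i) =
  abs_sign_sum R h.
Proof.
rewrite /abs_sign_sum; under [RHS]eq_bigr do rewrite normrEsg mulr_sumr.
rewrite exchange_big /= [RHS](eq_bigr _ (fun j _ => sum_sg_sign_swap R j i)).
by rewrite sumr_const card_ord mulr_natl.
Qed.

(* Flipping the signs [w] by the column [k] of [H] turns [sg (H^T w)_k] into
   [sg (\sum_i w_i)], whose correlation with every [w_i] is the same; what
   remains is the scalar product of the columns [k] and [l]. *)
Lemma sum_sg_orthogonal (R : realFieldType) (h : nat) (H : 'M[R]_h) :
  (forall i j, H i j = 1 \/ H i j = -1) -> H^T *m H = (h%:R)%:M ->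
  forall k l,
  \sum_w Num.sg (\sum_i H i k * sign_vec R w i) * (\sum_i H i l * sign_vec R w i) =
  abs_sign_sum R h * (k == l)%:R.
Proof.
move=> Hsign HH k l.
have h0 : h%:R != 0 :> R by rewrite pnatr_eq0; case: (h) k => [[]|].
pose p (w : {ffun 'I_h -> bool}) := [ffun i => w i (+) (H i k == -1)].
have pK : involutive p.
  by move=> w; apply/ffunP => i; rewrite !ffunE -addbA addbb addbF.
have Hp i w : sign_vec R (p w) i = H i k * sign_vec R w i.
  rewrite /sign_vec ffunE signr_addb mulrC; congr (_ * _).
  case: (Hsign i k) => ->; rewrite ?eqxx ?expr1 //.
  by rewrite -addr_eq0 (_ : 1 + 1 = 2%:R) // pnatr_eq0 expr0.
have HkK i : H i k * H i k = 1 by case: (Hsign i k) => ->; rewrite ?mulrNN mulr1.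
rewrite (reindex_inj (inv_inj pK)) /=.
transitivity (\sum_i H i l * H i k *
    (\sum_w Num.sg (\sum_j sign_vec R w j) * sign_vec R w i)).
  under [RHS]eq_bigr do rewrite mulr_sumr.
  rewrite exchange_big /=; apply: eq_bigr => w _.
  rewrite mulr_sumr; apply: eq_bigr => i _.
  under eq_bigr do rewrite Hp mulrA HkK mul1r.
  by rewrite Hp; ring.
apply: (mulfI h0); rewrite mulr_sumr.
under eq_bigr do rewrite mulrCA sum_sg_sign.
rewrite -mulr_suml.
have /matrixP/(_ k l) := HH; rewrite !mxE -[RHS]mulr_natr => HHkl.
rewrite mulrCA -HHkl mulrC; congr (_ * _).
by apply: eq_bigr => i _; rewrite mxE mulrC.
Qed.

Lemma sum_sign_card (R : pzRingType) (h : nat) (A : {set 'I_h}) :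
  \sum_k sign_vec R [ffun i => i \in A] k = h%:R - (2 * #|A|)%:R.
Proof.
have sE k : sign_vec R [ffun i => i \in A] k = 1 - 2 * (k \in A)%:R.
  rewrite /sign_vec ffunE; case: (k \in A); rewrite ?mulr0 ?subr0 //.
  by rewrite expr1 mulr1 opprD addNKr.
under eq_bigr do rewrite sE.
rewrite sumrB -mulr_sumr -natr_sum sumr_const card_ord natrM.
by rewrite -big_mkcond /= sum1_card.
Qed.

(** A sign vector is the set of its negative positions; grouping these sets by cardinality gives the
    binomial sum. *)
Lemma abs_sign_sumE (R : realDomainType) (m : nat) :
  abs_sign_sum R (2 * m) = (2 * m * 'C(2 * m, m))%:R.
Proof.
rewrite -sum_dist_bin /abs_sign_sum.
have bij : bijective (fun A : {set 'I_(2 * m)} => [ffun i => i \in A]).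
  exists (fun w : {ffun 'I_(2 * m) -> bool} => [set i | w i]%SET) => [A | w].
    by apply/setP => i; rewrite inE ffunE.
  by apply/ffunP => i; rewrite ffunE inE.
rewrite (reindex _ (onW_bij _ bij)) /=.
under eq_bigr do rewrite sum_sign_card.
have cardP (A : {set 'I_(2 * m)}) : (#|A| < (2 * m).+1)%N.
  by rewrite ltnS -[X in (_ <= X)%N]card_ord max_card.
rewrite (partition_big (fun A => Ordinal (cardP A)) xpredT) //= big_mkord.
apply: eq_bigr => k _.
have -> : 'C(2 * m, k) = #|[set A : {set 'I_(2 * m)} | #|A| == k]%SET|.
  by rewrite card_draws card_ord.
rewrite -sumr_const; apply: eq_big => [A | A /eqP <- //].
by rewrite inE.
Qed.

(** With [h = 2 m] this is [mu ^ 2 >= h / 2], cleared of the denominator [2 ^ h]. *)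
Lemma le_abs_sign_sum (R : realFieldType) (m : nat) :
  (2 ^ (2 * m))%:R ^+ 2 * m%:R <= abs_sign_sum R (2 * m) ^+ 2.
Proof.
rewrite abs_sign_sumE -!natrX -natrM ler_nat.
case: m => [|m]; first by rewrite muln0.
have -> : ((2 ^ (2 * m.+1)) ^ 2 = 16 ^ m.+1)%N.
  by rewrite -expnM mulnC mulnA expnM.
have := @exp16_le_central_bin m.+1 isT; nia.
Qed.

(** * Hadamard matrices and the bordered determinant *)

(** The products of corresponding entries in rows 0 and 1 sum to 0; adding 1 to each makes it 0 or
    2, so [h] is a sum of even numbers. The closed form for [mu] covers even lengths. *)
Lemma hadamard_order_even (h : nat) (H : 'M[int]_h) :
  (1 < h)%N -> is_hadamard H -> ~~ odd h.
Proof.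
case: h H => [|[|h]] // H _ [Hsign HHt].
have /matrixP/(_ 0 1) := HHt; rewrite !mxE mulr0n => sum0.
pose c j : nat := H 0 j * H 1 j == 1.
have cE j : 1 + H 0 j * H 1 j = (2 * c j)%N%:Z.
  by rewrite /c; case: (Hsign 0 j) => ->; case: (Hsign 1 j) => ->.
suff : h.+2%:Z = (2 * \sum_j c j)%N%:Z by case=> ->; rewrite mul2n odd_double.
rewrite big_distrr /= -[RHS]natz natr_sum /=.
under eq_bigr do rewrite natz -cE.
rewrite big_split /= sumr_const card_ord natz.
suff -> : \sum_j H 0 j * H 1 j = 0 by rewrite addr0.
by rewrite -[RHS]sum0; apply: eq_bigr => j _; rewrite mxE.
Qed.

(** Negating the first row stays in the box and flips the sign of the determinant. *)
Lemma norm_det_le_maxdet (R : realType) (n : nat) (A : 'M[R]_n) :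
  (0 < n)%N -> unit_box_mx A -> `|\det A| <= maxdet R n.
Proof.
case: n A => // n A _ boxA; have [_ ub] := maxdet_attained R n.+1.
rewrite ler_norml ub // andbT lerNl.
pose e : 'rV[R]_n.+1 := \row_i (if i == 0 then -1 else 1).
have det_e : \det (diag_mx e) = -1.
  rewrite det_diag (bigD1 0) //= mxE eqxx big1 ?mulr1 // => i /negPf i0.
  by rewrite mxE i0.
rewrite -[leLHS]mulN1r -det_e -det_mulmx; apply: ub => i j.
rewrite mul_diag_mx !mxE; case: eqP => _; last by rewrite mul1r; exact: boxA.
by rewrite mulN1r lerN2 lerNl andbC; exact: boxA.
Qed.

(* Multiply the bordered matrix on the right by [[H^T, - H^T B / h], [0, 1]]. *)
Lemma norm_det_border (R : rcfType) (h d : nat) (H : 'M[R]_h)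
    (B : 'M[R]_(h, d)) (C : 'M[R]_(d, h)) :
  (0 < h)%N -> H *m H^T = h%:R%:M ->
  `|\det (block_mx H B (- C) 0)| =
  Num.sqrt h%:R ^+ h * `|\det (C *m H^T *m B)| / h%:R ^+ d.
Proof.
move=> h_gt0 HHt; have h0 : h%:R != 0 :> R by rewrite pnatr_eq0 -lt0n.
set s := Num.sqrt _; have s0 : 0 < s by rewrite sqrtr_gt0 ltr0n.
have s2 : s ^+ 2 = h%:R by rewrite sqr_sqrtr ?ler0n.
have detH : `|\det H| = s ^+ h.
  apply/eqP; rewrite -(@eqrXn2 _ 2) ?exprn_ge0 ?(ltW s0) // -exprM mulnC exprM s2.
  by rewrite -normrX expr2 -{2}(det_tr H) -det_mulmx HHt det_scalar ger0_norm ?exprn_ge0.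
pose X := block_mx H^T (- (h%:R^-1 *: (H^T *m B))) 0 (1%:M : 'M[R]_d).
have E : block_mx H B (- C) 0 *m X =
  block_mx (h%:R%:M) 0 (- C *m H^T) (h%:R^-1 *: (C *m H^T *m B)).
  rewrite mulmx_block !mulmx0 !addr0 HHt mulmx1 mul0mx addr0; congr block_mx.
    rewrite mulmxN -scalemxAr mulmxA HHt mul_scalar_mx scalerA mulVf // scale1r.
    by rewrite addNr.
  by rewrite mulmxN mulNmx opprK -scalemxAr mulmxA.
have := congr1 (fun A => `|\det A|) E.
(* The product is block triangular, with determinant [h ^ h * det (C H^T B) / h ^ d] up to sign;
   dividing by [|det X| = s ^ h] leaves one factor [s ^ h]. *)
rewrite det_mulmx det_ublock det_lblock det1 mulr1 det_tr normrM detH.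
rewrite det_scalar detZ !normrM !normrX normfV !normr_nat exprVn -s2 -exprM.
move/(canRL (mulfK (lt0r_neq0 (exprn_gt0 h s0)))) => ->.
have sh : s ^+ h != 0 by rewrite expf_neq0 ?gt_eqF.
rewrite mulnC exprM expr2.
by rewrite -s2 -exprM exprM in h0 *; field; rewrite sh ?expf_neq0 ?gt_eqF.
Qed.

(** The maximum is at least the average over the sign columns [B]; both sides are multiplied by the
    number [(2 ^ h) ^ d] of choices. *)
Lemma maxdet_ge_average (R : realType) (h d : nat) :
  (0 < h)%N -> hadamard_orders h ->
  Num.sqrt h%:R ^+ h / h%:R ^+ d * (abs_sign_sum R h ^+ d * (h ^_ d)%:R) <=
  (2 ^ h)%:R ^+ d * maxdet R (h + d).
Proof.
move=> h_gt0 [_ [Hz [Hz_sign HzHzt]]].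
have h0 : h%:R != 0 :> R by rewrite pnatr_eq0 -lt0n.
pose H : 'M[R]_h := map_mx intr Hz.
have Hsign i j : H i j = 1 \/ H i j = -1.
  by rewrite mxE; case: (Hz_sign i j) => ->; [left | right].
have HHt : H *m H^T = h%:R%:M.
  rewrite matrix.map_trmx -map_mxM HzHzt map_scalar_mx /=; congr _%:M.
  by rewrite natz.
have HtH : H^T *m H = h%:R%:M.
  have /mulmx1C : (h%:R^-1 *: H) *m H^T = 1%:M.
    by rewrite -scalemxAl HHt -scalemx1 scalerA mulVf // scale1r.
  rewrite -scalemxAr => /(congr1 ( *:%R h%:R)).
  by rewrite scalerA mulfV // scale1r scalemx1.
rewrite -(sum_det_gram d (sum_sg_orthogonal Hsign HtH)) mulr_sumr.
have -> : (2 ^ h)%:R ^+ d * maxdet R (h + d) =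
  \sum_(b : {ffun 'I_d -> {ffun 'I_h -> bool}}) maxdet R (h + d).
  by rewrite sumr_const card_ffun card_ffun card_bool !card_ord -natrX mulr_natl.
apply: ler_sum => b _.
pose M w k := \sum_i H i k * sign_vec R w i.
pose B : 'M[R]_(h, d) := \matrix_(i, j) sign_vec R (b j) i.
pose C : 'M[R]_(d, h) := \matrix_(i, k) Num.sg (M (b i) k).
have -> : (\matrix_(i, j) \sum_k Num.sg (\sum_l H l k * sign_vec R (b i) l) *
    \sum_l H l k * sign_vec R (b j) l) = C *m H^T *m B.
  rewrite -mulmxA; apply/matrixP => i j; rewrite !mxE; apply: eq_bigr => k _.
  by rewrite !mxE; congr (_ * _); apply: eq_bigr => l _; rewrite !mxE.
apply: (@le_trans _ _ `|\det (block_mx H B (- C) 0)|); last first.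
  apply: norm_det_le_maxdet; first by rewrite addn_gt0 h_gt0.
  (* [Num.sg] is 0 at 0, so [C] may have zero entries; the box admits them. *)
  have sg_le1 (x : R) : -1 <= Num.sg x <= 1.
    by rewrite -ler_norml normr_sg; case: (_ == _).
  move=> i j; rewrite mxE; case: (fintype.split i) => {}i;
    rewrite mxE; case: (fintype.split j) => {}j.
  - by case: (Hsign i j) => ->; lra.
  - by rewrite mxE -ler_norml /sign_vec normrX normrN1 expr1n.
  - by rewrite !mxE lerN2 lerNl andbC.
  - by rewrite mxE; lra.
rewrite norm_det_border // mulrAC ler_wpM2r ?invr_ge0 ?exprn_ge0 //.
by rewrite ler_wpM2l ?exprn_ge0 ?sqrtr_ge0 ?ler_norm.
Qed.

(** * Elementary estimates *)

(** This is [h ^_ d / h ^ d >= 1 - d ^ 2 / h] without division or subtraction. The factor [h - d]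
    costs a further [d / h], and [d ^ 2 + d <= (d + 1) ^ 2]. *)
Lemma ffact_ge (h d : nat) : (h ^ d * h <= h ^_ d * h + d ^ 2 * h ^ d)%N.
Proof.
elim: d => [|d IH]; first by rewrite ffactn0 expn0 addn0.
have le_ffact : (h ^_ d <= h ^ d)%N.
  rewrite ffact_prod -[X in (_ <= _ ^ X)%N](card_ord d) -prod_nat_const.
  by rewrite leq_prod // => i _; lia.
rewrite ffactnSr expnS.
have : (h * (h ^ d * h) <= h * (h ^_ d * h + d ^ 2 * h ^ d))%N.
  by rewrite leq_mul2l IH orbT.
have : (h ^_ d * (d * h) <= h ^ d * (d * h))%N.
  by rewrite leq_mul2r le_ffact orbT.
(* Truncated subtraction is harmless: [h <= (h - d) + d] also when [h < d]. *)
have : (h ^_ d * h * h <= h ^_ d * (h - d) * h + h ^_ d * (d * h))%N.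
  rewrite mulnA -mulnDl -mulnDr leq_mul2r leq_mul2l; lia.
move: (h ^_ d * (h - d) * h)%N => Y.
lia.
Qed.

(* [24 / 17 = 1 / (1 - 7 / 24)] bounds [exp (7 / 24)], and the left-hand side is
   at most [exp (d + d ^ 2 / h) <= exp (7 d / 6)]. *)
Lemma expr_ratio_le (R : realType) (h d : nat) :
  (0 < d)%N -> (6 * d <= h)%N ->
  ((h + d)%:R / h%:R) ^+ (h + d) <= ((24 / 17) ^+ 2) ^+ 2 ^+ d :> R.
Proof.
move=> d_gt0 le_dh; rewrite -(exprM _ 2 2).
have h_gt0 : 0 < h%:R :> R by rewrite ltr0n; lia.
have e724 : expR (7 / 24 : R) <= 24 / 17.
  rewrite -[leRHS]invf_div -[7 / 24]opprK expRN lef_pV2 ?posrE ?expR_gt0 //.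
    by apply: le_trans (expR_ge1Dx _); lra.
apply: (@le_trans _ _ (expR (d%:R / h%:R) ^+ (h + d))).
  apply: lerXn2r; rewrite ?nnegrE ?expR_ge0 ?divr_ge0 ?ler0n //.
  apply: le_trans (expR_ge1Dx _); rewrite natrD mulrDl divff ?gt_eqF //.
apply: (@le_trans _ _ (expR (7 / 24) ^+ (2 * 2) ^+ d)).
  rewrite -exprM -!expRM_natl ler_expR mulrA ler_pdivrMr //.
  have : 6 * d%:R <= h%:R :> R by rewrite -natrM ler_nat.
  have : 0 <= d%:R :> R by [].
  by rewrite !natrM natrD; nra.
by rewrite !lerXn2r ?nnegrE ?exprn_ge0 ?expR_ge0 ?lerXn2r ?nnegrE ?expR_ge0 //; lra.
Qed.

(** * From the average to the two bounds *)

(** Divided by [h ^ (n / 2)], the average is [(mu / sqrt h) ^ d * h ^_ d / h ^ d]; [r] is a lower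
    approximation of [sqrt (1 / 2)], hence of [mu / sqrt h]. *)
Lemma maxdet_ratio_ge (R : realType) (r : R) (h d : nat) :
  0 <= r -> r ^+ 2 <= 1 / 2 -> (2 < h)%N -> hadamard_orders h ->
  r ^+ d * (1 - d%:R ^+ 2 / h%:R) <=
  maxdet R (h + d) / Num.sqrt h%:R ^+ (h + d).
Proof.
move=> r_ge0 r2 h_gt2 Hh.
have h_gt0 : 0 < h%:R :> R by rewrite ltr0n; lia.
set s := Num.sqrt _; have s_gt0 : 0 < s by rewrite sqrtr_gt0.
have s2 : s ^+ 2 = h%:R by rewrite sqr_sqrtr ?ltW.
have N_gt0 : 0 < (2 ^ h)%:R :> R by rewrite ltr0n expn_gt0.
have hE : (2 * h./2)%N = h.
  have [_ [H /hadamard_order_even]] := Hh.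
  by move/(_ (ltnW h_gt2)) => h_even; rewrite mul2n even_halfK.
have := maxdet_ge_average R d (ltnW (ltnW h_gt2)) Hh.
have := le_abs_sign_sum R h./2; rewrite hE -/s.
have : 0 <= abs_sign_sum R h by rewrite sumr_ge0.
move: (abs_sign_sum R h) => K.
move: (2 ^ h)%:R N_gt0 => N N_gt0 K_ge0 K2 avg.
have K_ge : r * s * N <= K.
  rewrite -ler_sqr ?nnegrE ?mulr_ge0 ?(ltW s_gt0) ?(ltW N_gt0) //.
  apply: le_trans K2; rewrite 2!exprMn s2 -{1}hE natrM.
  have : 0 <= (1 / 2 - r ^+ 2) * ((h./2)%:R * N ^+ 2).
    by rewrite mulr_ge0 ?subr_ge0 // mulr_ge0 ?exprn_ge0 // ltW.
  by nra.
rewrite ler_pdivlMr ?exprn_gt0 // -(ler_pM2l (exprn_gt0 d N_gt0)).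
apply: le_trans avg.
have fE : (1 - d%:R ^+ 2 / h%:R) * h%:R ^+ d <= (h ^_ d)%:R :> R.
  rewrite -(ler_pM2r h_gt0) mulrBl mul1r mulrBl mulrAC mulrVK ?unitfE ?gt_eqF //.
  by rewrite lerBlDr -!natrX -!natrM -natrD ler_nat ffact_ge.
apply: (@le_trans _ _ (s ^+ h / h%:R ^+ d *
    ((r * s * N) ^+ d * ((1 - d%:R ^+ 2 / h%:R) * h%:R ^+ d)))).
  rewrite !exprMn exprD le_eqVlt; apply/orP; left; apply/eqP; field.
  by rewrite ?expf_neq0 ?gt_eqF.
rewrite ler_wpM2l ?divr_ge0 ?exprn_ge0 ?(ltW s_gt0) ?(ltW h_gt0) //.
(* The falling factorial is inserted before [K], because [1 - d ^ 2 / h] may be negative while the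
   multipliers in this order are nonnegative. *)
apply: (@le_trans _ _ ((r * s * N) ^+ d * (h ^_ d)%:R)).
  by rewrite ler_wpM2l ?exprn_ge0 ?mulr_ge0 ?(ltW s_gt0) ?(ltW N_gt0).
rewrite ler_wpM2r ?ler0n // lerXn2r ?nnegrE ?mulr_ge0 ?(ltW s_gt0) ?(ltW N_gt0) //.
Qed.

Theorem theorem3 (R : realType) (d h : nat) :
  (0 < d)%N -> hadamard_orders h ->
  let n := (h + d)%N in
  let delta : R := 6 * d%:R ^+ 3 / h%:R in
  delta <= 1 ->
  maxdet R n / h%:R `^ (n%:R / 2) >= (594 / 1000) ^+ d * (1 - 93 / 100 * delta) /\
  (norm_maxdet R n >= (352 / 1000) ^+ d * (1 - 93 / 100 * delta) /\
   (352 / 1000) ^+ d * (1 - 93 / 100 * delta) >= 7 / 100 * (352 / 1000) ^+ d).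
Proof.
move=> d_gt0 Hh n delta delta_le1.
have h_gt0 : (0 < h)%N by case: Hh.
have hR : 0 < h%:R :> R by rewrite ltr0n.
have dR : 1 <= d%:R :> R by rewrite ler1n.
have le_dh : (6 * d ^ 3 <= h)%N.
  by move: delta_le1; rewrite /delta ler_pdivrMr // mul1r -natrX -natrM ler_nat.
have h_gt2 : (2 < h)%N.
  by have := expn_gt0 d 3; rewrite d_gt0 /=; lia.
have le_6dh : (6 * d <= h)%N.
  by apply: leq_trans le_dh; rewrite leq_mul2l expnS leq_pmulr ?expn_gt0 ?d_gt0.
have powE (m : nat) : m%:R `^ (n%:R / 2) = Num.sqrt m%:R ^+ n :> R.
  by rewrite mulrC powRrM powR12_sqrt ?ler0n // powR_mulrn ?sqrtr_ge0.
pose x : R := d%:R ^+ 2 / h%:R.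
(* In fact [x = delta / (6 d) <= delta / 6]. *)
have x_le : x <= 93 / 100 * delta.
  rewrite /x /delta mulrA ler_pM2r ?invr_gt0 // mulrA exprSr.
  have : 0 <= d%:R ^+ 2 :> R by rewrite exprn_ge0.
  by nra.
have delta7 : 7 / 100 <= 1 - 93 / 100 * delta by lra.
have := @maxdet_ratio_ge R (707 / 1000) h d _ _ h_gt2 Hh.
have : 0 <= 352 / 1000 :> R by lra.
have : (0 <= 594 / 1000 :> R) && (594 / 1000 <= 707 / 1000 :> R).
  by apply/andP; split; lra.
(* Replacing [h ^ (n / 2)] by [n ^ (n / 2)] costs a factor of at most [((24 / 17) ^ 2) ^ d], which
   the gap between 0.352 and 0.707 absorbs. *)
have : 352 / 1000 * (24 / 17) ^+ 2 <= 707 / 1000 :> R by lra.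
have : 0 <= 707 / 1000 :> R by lra.
have : (707 / 1000) ^+ 2 <= 1 / 2 :> R by lra.
have : 0 <= (24 / 17) ^+ 2 :> R by lra.
have := expr_ratio_le R d_gt0 le_6dh.
(* Generalized because conversion would unfold these numerals in unary. *)
move: (707 / 1000) (594 / 1000) (352 / 1000) ((24 / 17) ^+ 2) => r a b c.
move=> ratio c_ge0 r2 r_ge0 bc_le /andP[a_ge0 le_ar] b_ge0 /(_ r_ge0 r2).
have : 0 <= 7 / 100 :> R by lra.
have : 1 - 93 / 100 * delta <= 1 - d%:R ^+ 2 / h%:R by rewrite lerD2l lerN2.
move: delta7; set y : R := 1 - 93 / 100 * delta; set e : R := 7 / 100.
clearbody y e => le_ey y_le e_ge0 main.
have y_ge0 : 0 <= y by exact: le_trans le_ey.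
have {}main := le_trans (ler_wpM2l (exprn_ge0 d r_ge0) y_le) main.
split; last split.
- rewrite powE; apply: le_trans main.
  by rewrite ler_wpM2r // lerXn2r ?nnegrE.
- rewrite /norm_maxdet powE.
  set s := Num.sqrt h%:R in main; set t := Num.sqrt _.
  have s_gt0 : 0 < s by rewrite sqrtr_gt0.
  have t_gt0 : 0 < t by rewrite sqrtr_gt0 ltr0n addn_gt0 h_gt0.
  (* Squaring removes the roots and leaves the bound [ratio] on [(n / h) ^ n]. *)
  have ts : (t / s) ^+ n <= c ^+ d.
    rewrite -ler_sqr ?nnegrE ?exprn_ge0 ?divr_ge0 ?(ltW s_gt0) ?(ltW t_gt0) //.
    by rewrite exprAC [c ^+ d ^+ 2]exprAC expr_div_n !sqr_sqrtr ?ler0n.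
  have -> : maxdet R n / t ^+ n = maxdet R n / s ^+ n / (t / s) ^+ n.
    by rewrite expr_div_n; field; rewrite !expf_neq0 ?gt_eqF.
  rewrite ler_pdivlMr ?exprn_gt0 ?divr_gt0 //; apply: le_trans main.
  apply: (@le_trans _ _ (b ^+ d * y * c ^+ d)).
    by rewrite ler_wpM2l // mulr_ge0 ?exprn_ge0.
  by rewrite mulrAC -exprMn ler_wpM2r // lerXn2r ?nnegrE ?mulr_ge0.
- by rewrite mulrC ler_wpM2l ?exprn_ge0.
Qed.
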